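(* Fix an equation $(f,q,w)$ as in the context and let $\xi:=\arctan(-1/f_0)+\pi$ if $f_0>0$ and $\xi:=\arctan(-1/f_0)$ if $f_0<0$ (so $\xi\in(0,\pi)$). For $\alpha\in[0,\pi)$, $\beta\in(0,\pi]$ let $\mathbf S_{\alpha,\beta}$ be the separated self-adjoint boundary condition $\cos\alpha\,y_0-\sin\alpha\,f_0\Delta y_0=0$, $\cos\beta\,y_N-\sin\beta\,f_N\Delta y_N=0$, and write $\lambda_n(\alpha,\beta)$ for the $n$-th eigenvalue of the problem with this boundary condition. Then the problem with $\mathbf S_{\alpha,\beta}$ has exactly $N$ eigenvalues if $\alpha\neq\xi$ and $\beta\neq\pi$; exactly $N-1$ eigenvalues if either $\alpha\neq\xi,\ \beta=\pi$ or $\alpha=\xi,\ \beta\neq\pi$; and exactly $N-2$ eigenvalues if $\alpha=\xi$ and $\beta=\pi$. Moreover, for any $0\le\alpha_1<\alpha_2<\xi\le\alpha_3<\alpha_4<\pi$ and $0<\beta_1<\beta_2\le\pi$: (i) for every $\beta_0\in(0,\pi)$: for each $0\le n\le N-2$, $\lambda_n(\alpha_2,\beta_0)<\lambda_n(\alpha_1,\beta_0)<\lambda_n(\alpha_4,\beta_0)<\lambda_n(\alpha_3,\beta_0)<\lambda_{n+1}(\alpha_2,\beta_0)$, and $\lambda_{N-1}(\alpha_2,\beta_0)<\lambda_{N-1}(\alpha_1,\beta_0)<\lambda_{N-1}(\alpha_4,\beta_0)$; in addition $\lambda_{N-1}(\alpha_4,\beta_0)<\lambda_{N-1}(\alpha_3,\beta_0)$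 if $\alpha_3\neq\xi$; (ii) for $\beta_0=\pi$: for each $0\le n\le N-3$, $\lambda_n(\alpha_2,\pi)<\lambda_n(\alpha_1,\pi)<\lambda_n(\alpha_4,\pi)<\lambda_n(\alpha_3,\pi)<\lambda_{n+1}(\alpha_2,\pi)$, and $\lambda_{N-2}(\alpha_2,\pi)<\lambda_{N-2}(\alpha_1,\pi)<\lambda_{N-2}(\alpha_4,\pi)$; in addition $\lambda_{N-2}(\alpha_4,\pi)<\lambda_{N-2}(\alpha_3,\pi)$ if $\alpha_3\neq\xi$; (iii) for every $\alpha_0\in[0,\xi)\cup(\xi,\pi)$: for each $0\le n\le N-2$, $\lambda_n(\alpha_0,\beta_1)<\lambda_n(\alpha_0,\beta_2)<\lambda_{n+1}(\alpha_0,\beta_1)$; in addition $\lambda_{N-1}(\alpha_0,\beta_1)<\lambda_{N-1}(\alpha_0,\beta_2)$ if $\beta_2\neq\pi$; (iv) for $\alpha_0=\xi$: for each $0\le n\le N-3$, $\lambda_n(\xi,\beta_1)<\lambda_n(\xi,\beta_2)<\lambda_{n+1}(\xi,\beta_1)$; in addition $\lambda_{N-2}(\xi,\beta_1)<\lambda_{N-2}(\xi,\beta_2)$ if $\beta_2\neq\pi$.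
   Context: Let $N\ge2$ be an integer. An equation is given by real sequences $f=\{f_n\}_{n=0}^N$, $q=\{q_n\}_{n=1}^N$, $w=\{w_n\}_{n=1}^N$ with $f_n\neq0$ for $0\le n\le N$ and $w_n>0$ for $1\le n\le N$; it is the discrete Sturm–Liouville equation $-\nabla(f_n\Delta y_n)+q_ny_n=\lambda w_ny_n$, $1\le n\le N$, for $y=\{y_n\}_{n=0}^{N+1}$, where $\Delta y_n=y_{n+1}-y_n$, $\nabla y_n=y_n-y_{n-1}$. A boundary condition $[A\,|\,B]$ is $A(y_0,f_0\Delta y_0)^T+B(y_N,f_N\Delta y_N)^T=0$ with complex $2\times2$ matrices $A,B$, $\mathrm{rank}(A,B)=2$; two $2\times4$ matrices $(A,B)$ define the same boundary condition iff they differ by left multiplication by an invertible complex $2\times2$ matrix. It is self-adjoint if $AJA^*=BJB^*$, $J=\begin{pmatrix}0&1\\-1&0\end{pmatrix}$. $\lambda\in\mathbb C$ is an eigenvalue of the problem (equation plus boundary condition) if there is a nontrivial solution. For self-adjoint boundary conditions all eigenvalues are real and finitely many; the multiplicity of an eigenvalue is the dimension of its solution space (it equals its multiplicity as a zero of the characteristic polynomial). The eigenvalues counted with multiplicity number $k$ with $N-2\le k\le N$ (''exactly $k$ eigenvalues'') and are ordered $\lambda_0\le\lambda_1\le\cdots\le\lambda_{k-1}$; $\lambda_n$ is the $n$-th eigenvalue. *)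

(* Defs.v *)
From HB Require Import structures.
From mathcomp Require Import all_boot all_order all_algebra.
From mathcomp Require Import complex.
From mathcomp Require Import reals trigo.
Set Implicit Arguments. Unset Strict Implicit. Unset Printing Implicit Defensive.
Import Order.TTheory GRing.Theory Num.Theory.
Local Open Scope ring_scope.

Section SL.
Variable R : realType.
Local Notation C := (R[i]).
Local Notation "x %:C" := (real_complex R x) : ring_scope.

(* The discrete Sturm-Liouville problem on y = (y_0,...,y_{N+1}), a row vector
   in C^(N+2) (entry i is y_i).  The equation data f_0..f_N, q_1..q_N, w_1..w_N
   are given as functions nat -> R (values outside the index range are unused).
   A boundary condition [A | B] is given by A B : 'M[C]_2. *)

Definition yat (N : nat) (y : 'rV[C]_(N.+2)) (k : nat) : C := y 0 (inord k).

(* The residual map: component 0 and N+1 are the two rows of the boundary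
   condition A (y_0, f_0 Δy_0)^T + B (y_N, f_N Δy_N)^T, component n (1<=n<=N)
   is  -∇(f_n Δy_n) + q_n y_n - λ w_n y_n.  y is a solution iff residual = 0. *)
Definition sl_residual (N : nat) (f q w : nat -> R) (A B : 'M[C]_2) (lam : C)
  (y : 'rV[C]_(N.+2)) : 'rV[C]_(N.+2) :=
  \row_(j < N.+2)
    let Y := yat y in
    if (j == 0 :> nat) || (j == N.+1 :> nat) then
      let k : 'I_2 := if j == 0 :> nat then 0 else 1 in
      A k 0 * Y 0%N + A k 1 * ((f 0%N)%:C * (Y 1%N - Y 0%N))
      + B k 0 * Y N + B k 1 * ((f N)%:C * (Y N.+1 - Y N))
    else
      - ((f j)%:C * (Y j.+1 - Y j) - (f j.-1)%:C * (Y j - Y j.-1))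
      + (q j)%:C * Y j - lam * (w j)%:C * Y j.

Definition sl_solspace N f q w A B lam : 'M[C]_(N.+2) :=
  kermx (lin1_mx (@sl_residual N f q w A B lam)).

Definition sl_mult N f q w A B lam : nat := \rank (sl_solspace N f q w A B lam).

Definition sl_is_eigenvalue N f q w A B lam : Prop :=
  (0 < sl_mult N f q w A B lam)%N.

(* L is the list of the eigenvalues, counted with multiplicity, in
   nondecreasing order: L is sorted, and every complex number z occurs in
   (the complexification of) L exactly (multiplicity of z) times.  In
   particular all eigenvalues are real and the number of eigenvalues (with
   multiplicity) is size L; the n-th eigenvalue is nth 0 L n. *)
Definition sl_eigenlist N f q w A B (L : seq R) : Prop :=
  sorted <=%R L /\
  forall z : C, count (fun x => x%:C == z) L = sl_mult N f q w A B z.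

(* The separated boundary condition S_{α,β}:
   cos α y_0 - sin α f_0 Δy_0 = 0,  cos β y_N - sin β f_N Δy_N = 0. *)
Definition sepA (a : R) : 'M[C]_2 :=
  \matrix_(i < 2, j < 2)
    if i == 0 then (if j == 0 then (cos a)%:C else - (sin a)%:C) else 0.
Definition sepB (b : R) : 'M[C]_2 :=
  \matrix_(i < 2, j < 2)
    if i == 0 then 0 else (if j == 0 then (cos b)%:C else - (sin b)%:C).

Definition sep_eigenlist N f q w (a b : R) (L : seq R) : Prop :=
  sl_eigenlist N f q w (sepA a) (sepB b) L.

Definition xi_of (f0 : R) : R :=
  if 0 < f0 then atan (- 1 / f0) + pi else atan (- 1 / f0).

End SL.

(* Main.v *)
(** Running the equation from left to right turns the initial values
    (y_1, f_0 Δy_0) = (sin a + cos a / f_0, cos a) into polynomials in λ, and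
    the eigenvalues are the zeros of D = cos b y_N - sin b f_N Δy_N, each with a
    one-dimensional solution space.  Lagrange's identity excludes nonreal zeros
    of D and makes the Wronskian in λ of y_N and f_N Δy_N a sum of squares of
    constant sign; hence the zeros are simple, their number is the degree
    N - 2 + [a <> ξ] + [b <> π], and D' has at every zero of D the sign, up to
    sin (b - b'), of the polynomial for another angle b'.  Counting the zeros of
    one polynomial above each zero of the other, the parities force strict
    interlacing.  D is invariant under reversing the recursion and exchanging
    the two boundary vectors, so the dependence on a reduces to that on b. *)

Require Import Defs.
From HB Require Import structures.
From mathcomp Require Import all_boot all_order all_algebra.
From mathcomp Require Import complex.
From mathcomp Require Import reals trigo.
From mathcomp Require Import ring lra zify.
Import Order.TTheory GRing.Theory Num.Theory.
Local Open Scope ring_scope.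

Set Implicit Arguments. Unset Strict Implicit. Unset Printing Implicit Defensive.

(** * Interlacing of real-rooted polynomials *)

Section Interlacing.
Variable R : realFieldType.
Implicit Types (s t : seq R) (x y : R).

Definition nabove s x := count (fun y => x < y) s.

(** The entries above [x] form the tail of a sorted list, so comparing [x] with an entry amounts to
    comparing indices. *)
Lemma sorted_lt_nth s x i : sorted <=%R s -> (i < size s)%N ->
  (x < nth 0 s i) = (size s <= i + nabove s x)%N.
Proof.
elim: s i => [//|y s IHs] i /= ys; have ss := path_sorted ys.
have cs := count_size (fun z => x < z) s.
rewrite /nabove /=; case: (ltP x y) => [xy|yx].
  have above : all (fun z => x < z) s.
    apply/allP=> z zs; apply: lt_le_trans xy _.
    by have /allP/(_ z zs) := order_path_min le_trans ys.
  move: (above); rewrite all_count => /eqP ->.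
  case: i => [|i] lt_is; first by rewrite /= xy; lia.
  by rewrite /= (allP above) ?mem_nth //; lia.
case: i => [_|i]; rewrite /= ?ltnS ?add0n.
  by rewrite ltNge yx ltnNge cs.
exact: IHs.
Qed.

Lemma nabove_nth s i : sorted <%R s -> (i < size s)%N ->
  nabove s (nth 0 s i) = (size s - i.+1)%N.
Proof.
move=> ss lt_is; have les := sub_sorted (@ltW _ _) ss.
have := sorted_lt_nth (nth 0 s i) les lt_is; rewrite ltxx => /esym/negbT.
rewrite -ltnNge => lt1.
have [lt_iS|] := ltnP i.+1 (size s); last by lia.
have := sorted_lt_nth (nth 0 s i) les lt_iS.
by rewrite (lt_sorted_ltn_nth 0 ss) ?inE // ltnSn => /esym; lia.
Qed.

Lemma sgr_horner_prod_XsubC s x : x \notin s ->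
  Num.sg (\prod_(y <- s) ('X - y%:P)).[x] = (-1) ^+ nabove s x.
Proof.
elim: s => [|y s IHs]; first by rewrite big_nil hornerE sgr1.
rewrite inE negb_or => /andP[xy xs]; rewrite big_cons !hornerE sgrM IHs //.
rewrite /nabove /= exprD; congr (_ * _).
case: ltgtP xy => // [lt_xy|lt_yx] _; first by rewrite ltr0_sg ?subr_lt0.
by rewrite gtr0_sg ?subr_gt0.
Qed.

Lemma horner_deriv_prod_XsubC s x : x \in s ->
  (\prod_(y <- s) ('X - y%:P))^`().[x] =
  (\prod_(y <- rem x s) ('X - y%:P)).[x].
Proof.
move=> xs; rewrite (perm_big _ (perm_to_rem xs)) big_cons /=.
by rewrite derivM derivXsubC !hornerE subrr ?(mul0r, addr0).
Qed.

(** A repeated entry [x] survives in [rem x s], so the derivative of the product still vanishes at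
    [x]. *)
Lemma uniq_simple_roots c s :
  (forall x, x \in s -> (c *: \prod_(y <- s) ('X - y%:P))^`().[x] != 0) ->
  uniq s.
Proof.
move=> simple; apply: count_mem_uniq => x.
have [xs|/count_memPn ->//] := boolP (x \in s).
rewrite (permP (perm_to_rem xs)) /= eqxx addnC addn1; congr _.+1.
apply/count_memPn; apply/negP => xrem; have /negP[] := simple x xs.
rewrite derivZ hornerZ horner_deriv_prod_XsubC // (perm_big _ (perm_to_rem xrem)).
by rewrite big_cons hornerM hornerXsubC subrr mul0r mulr0.
Qed.

Lemma parity_descent (K : nat -> nat) n m :
  (m <= n <= m.+1)%N ->
  (forall i, i < n -> K i <= m)%N ->
  (forall i, i.+1 < n -> K i.+1 <= K i)%N ->
  (forall i, (i < n)%N -> odd (K i + i) = odd m) ->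
  forall i, (i < n)%N -> K i = (m - i)%N.
Proof.
move=> nm Km Kdec Kodd.
have up i : (i < n)%N -> (K i <= m - i)%N.
  elim: i => [|i IHi] lt_in; first by rewrite subn0 Km.
  by have := IHi (ltnW lt_in); have := Kdec i lt_in; have := Kodd i.+1 lt_in; lia.
(* At the last index the bound [m - i] is 0 or 1, and parity settles it; going backwards, each value
   exceeds the next one. *)
have down j i : (i + j)%N = n.-1 -> (i < n)%N -> (m - i <= K i)%N.
  elim: j i => [|j IHj] i ij lt_in; first by have := Kodd i lt_in; lia.
  have lt_iS : (i.+1 < n)%N by lia.
  by have := IHj i.+1 ltac:(lia) lt_iS; have := Kdec i lt_iS;
     have := Kodd i lt_in; lia.
by move=> i lt_in; apply/eqP; rewrite eqn_leq up // (down (n.-1 - i)%N) //; lia.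
Qed.

(* At a root x of F the hypothesis fixes the sign of F'(x) G(x), hence the
   parity of the number of roots of G above x; these numbers decrease along s,
   so the parity determines them. *)
Lemma interlacing (c d : R) s t :
  let F := c *: \prod_(y <- s) ('X - y%:P) in
  let G := d *: \prod_(y <- t) ('X - y%:P) in
  sorted <%R s -> sorted <%R t -> (size t <= size s <= (size t).+1)%N ->
  (forall x, x \in s ->
     0 < (-1) ^+ (size s + size t).+1 * (c * d) * (F^`().[x] * G.[x])) ->
  forall i, (i < size t)%N ->
    ((i < size s)%N -> nth 0 s i < nth 0 t i) /\
    ((i.+1 < size s)%N -> nth 0 t i < nth 0 s i.+1).
Proof.
move=> F G ss st sz W.
have ls := sub_sorted (@ltW _ _) ss; have lt := sub_sorted (@ltW _ _) st.
have notin x : x \in s -> x \notin t.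
  move=> xs; apply/negP => xt; have := W x xs.
  rewrite /G hornerZ (perm_big _ (perm_to_rem xt)) big_cons hornerM.
  rewrite hornerXsubC subrr.
  by rewrite ?(mul0r, mulr0) ltxx.
have KE : forall i, (i < size s)%N -> nabove t (nth 0 s i) = (size t - i)%N.
  apply: (@parity_descent (fun i => nabove t (nth 0 s i))) => //
    [i _|i lt_is|i lt_is].
  - exact: count_size.
  - apply: sub_count => y; apply: lt_trans.
    by rewrite (lt_sorted_ltn_nth 0 ss) ?inE // ltnW.
  have xs := mem_nth 0 lt_is; have us := lt_sorted_uniq ss.
  have := W _ xs; rewrite -sgr_gt0 !(sgrM, derivZ, hornerZ).
  rewrite horner_deriv_prod_XsubC // sgr_horner_prod_XsubC; last first.
    by rewrite mem_rem_uniq // inE eqxx.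
  rewrite sgr_horner_prod_XsubC ?notin // sgrX sgrN1.
  (* [nabove] counts strictly larger entries, so deleting the root itself does not change it. *)
  have -> : nabove (rem (nth 0 s i) s) (nth 0 s i) = (size s - i.+1)%N.
    rewrite -(nabove_nth ss lt_is) /nabove (permP (perm_to_rem xs)) /=.
    by rewrite ltxx.
  have [->|c0] := eqVneq c 0; first by rewrite sgr0 !(mul0r, mulr0) ltxx.
  have [->|d0] := eqVneq d 0; first by rewrite sgr0 !(mul0r, mulr0) ltxx.
  set e1 := (_ - _)%N; set k := nabove _ _.
  rewrite [X in _ < X](_ : _ = (Num.sg c ^+ 2 * Num.sg d ^+ 2) *
     ((-1) ^+ (size s + size t).+1 * (-1) ^+ e1 * (-1) ^+ k)); last by ring.
  rewrite !sqr_sg c0 d0 mul1r mul1r -!exprD -signr_odd.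
  case Ho: (odd _); first by rewrite expr1 ltr0N1.
  by move: Ho => + _; rewrite /e1; lia.
move=> i lt_it; split=> [lt_is|lt_iS].
  by rewrite sorted_lt_nth // KE //; lia.
(* Counting gives only the weak inequality; equality would be a common root, excluded by [notin]. *)
rewrite lt_neqAle leNgt sorted_lt_nth // KE //.
apply/andP; split; last by lia.
by apply: contraNneq (notin _ (mem_nth 0 lt_iS)) => <-; apply: mem_nth.
Qed.

End Interlacing.

(** * Recursion and its reversal *)

Section Sweep.
Variable A : comNzRingType.
Implicit Types (k g : nat -> A) (l r : A * A).

(* With l = (y_1, f_0 Δy_0), k_i = q_(i+1) - λ w_(i+1) and g_i = 1 / f_(i+1), the
   n-th pair is (y_(n+1), f_(n+1) Δy_(n+1)). *)
Fixpoint sweep k g l n : A * A :=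
  if n is n'.+1 then
    let p := sweep k g l n' in
    let u := p.1 + g n' * p.2 in (u, p.2 + k n * u)
  else (l.1, l.2 + k 0%N * l.1).

Lemma sweepS1 k g l n :
  (sweep k g l n.+1).1 = (sweep k g l n).1 + g n * (sweep k g l n).2.
Proof. by []. Qed.

Lemma sweepS2 k g l n :
  (sweep k g l n.+1).2 = (sweep k g l n).2 + k n.+1 * (sweep k g l n.+1).1.
Proof. by []. Qed.

Definition sweep_pairing k g l r n :=
  r.2 * (sweep k g l n).1 + r.1 * (sweep k g l n).2.

(** Both sides are the Wronskian of the solution started on the left from [l] and the one started on
    the right from [r], evaluated at the two ends. The plus sign in the pairing comes from the
    reversed orientation of the differences. *)
Lemma sweep_pairing_rev k g l r n :
  sweep_pairing k g l r n =
  sweep_pairing (fun i => k (n - i)%N) (fun i => g (n.-1 - i)%N) r l n.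
Proof.
rewrite /sweep_pairing; set k' := fun i => k (n - i)%N; set g' := fun i => _.
case: n @k' @g' => [|n] k' g'; first by rewrite /= /k'; ring.
pose S := sweep k g l; pose T := sweep k' g' r.
(* [Q j] pairs the two solutions at site [j.+1], with the differences taken across the bond to its
   left. *)
pose Q j := (S j.+1).1 * (T (n - j)%N).2 + (T (n - j)%N).1 * (S j).2.
have Qconst j : (j <= n)%N -> Q j = Q 0%N.
  elim: j => // j IHj lt_jn; rewrite -(IHj (ltnW lt_jn)) /Q /S /T.
  have -> : (n - j)%N = (n - j.+1).+1 by lia.
  rewrite [in RHS]sweepS2 !sweepS1 sweepS2 sweepS1 /k' /g' /=.
  have -> : (n.+1 - (n - j.+1).+1)%N = j.+1 by lia.
  have -> : (n - (n - j.+1))%N = j.+1 by lia.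
  by ring.
transitivity (Q n).
  by rewrite /Q subnn /S sweepS2 /T /= /k' subn0; ring.
rewrite Qconst // /Q subn0 /T sweepS2 !sweepS1 /S /= /g' /k' subnn subnn /=.
by ring.
Qed.

(** The steps by [g] are common to both sweeps and preserve the Wronskian; only the differing kicks
    contribute. *)
Lemma sweep_lagrange k k' g l n :
  let S := sweep k g l in let S' := sweep k' g l in
  (S n).1 * (S' n).2 - (S' n).1 * (S n).2 =
  \sum_(i < n.+1) (k' i - k i) * ((S i).1 * (S' i).1).
Proof.
move=> S S'; elim: n => [|n IHn]; first by rewrite big_ord1 /=; ring.
rewrite big_ord_recr -IHn /S /S' !sweepS2 !sweepS1 /=; ring.
Qed.

End Sweep.

Lemma rmorph_sweep (A B : comNzRingType) (h : {rmorphism A -> B}) k g l n :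
  sweep (h \o k) (h \o g) (h l.1, h l.2) n =
  (h (sweep k g l n).1, h (sweep k g l n).2).
Proof.
by elim: n => [|n IHn] /=; rewrite ?IHn /= ?(rmorphD, rmorphM).
Qed.

Lemma rmorph_sweep_pairing (A B : comNzRingType) (h : {rmorphism A -> B})
    k g l r n :
  h (sweep_pairing k g l r n) =
  sweep_pairing (h \o k) (h \o g) (h l.1, h l.2) (h r.1, h r.2) n.
Proof. by rewrite /sweep_pairing rmorph_sweep /= rmorphD !rmorphM. Qed.

Lemma eq_sweep (A : comNzRingType) (k k' g g' : nat -> A) l n :
  (forall i, (i <= n)%N -> k i = k' i) -> (forall i, (i < n)%N -> g i = g' i) ->
  sweep k g l n = sweep k' g' l n.
Proof.
elim: n => [|n IHn] kk gg /=; first by rewrite kk.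
rewrite IHn ?kk ?gg // => i lt_in; first by rewrite kk // leqW.
by rewrite gg // leqW.
Qed.

(** If the first value is zero, the second is [g 0 * l.2]. This makes the weighted sums of squares
    below strictly positive. *)
Lemma sweep_neq0 (K : idomainType) (k g : nat -> K) l :
  l != (0, 0) -> g 0%N != 0 ->
  ((sweep k g l 0).1 != 0) || ((sweep k g l 1).1 != 0).
Proof.
case: l => l1 l2; rewrite xpair_eqE negb_and /= => l0 g0.
have [l10|//] := eqVneq l1 0; move: l0; rewrite l10 eqxx mulr0 addr0 add0r /=.
exact: mulf_neq0.
Qed.

(** * Characteristic polynomial *)

Section CharacteristicPolynomial.
Variable R : realType.
Local Notation C := R[i].
Implicit Types (q w g : nat -> R) (l r : R * R) (p : {poly R}).

Definition kickp q w i : {poly R} := (q i)%:P - (w i)%:P * 'X.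

Definition sweepp q w g l :=
  sweep (kickp q w) (fun i => (g i)%:P) (l.1%:P, l.2%:P).

Definition charp q w g l r n : {poly R} :=
  sweep_pairing (kickp q w) (fun i => (g i)%:P) (l.1%:P, l.2%:P)
    (r.1%:P, r.2%:P) n.

Lemma charpE q w g l r n :
  charp q w g l r n =
  r.2%:P * (sweepp q w g l n).1 + r.1%:P * (sweepp q w g l n).2.
Proof. by []. Qed.

Lemma charp_rev q w g l r n :
  charp q w g l r n =
  charp (fun i => q (n - i)%N) (fun i => w (n - i)%N)
    (fun i => g (n.-1 - i)%N) r l n.
Proof. exact: sweep_pairing_rev. Qed.

(** Evaluation of a real polynomial at a complex point, set up as a composite of ring morphisms so
    that it commutes with the sweep. *)
Definition complex_horner (z : C) : {poly R} -> C :=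
  horner_eval z \o map_poly (real_complex R).
HB.instance Definition _ z := GRing.RMorphism.on (complex_horner z).

Lemma complex_hornerC z (c : R) : complex_horner z c%:P = (c%:C)%C.
Proof. by rewrite /complex_horner /= map_polyC /= /horner_eval hornerC. Qed.

Definition kickC q w (z : C) i : C := ((q i)%:C - (w i)%:C * z)%C.

Lemma complex_horner_charp q w g l r n z :
  complex_horner z (charp q w g l r n) =
  sweep_pairing (kickC q w z) (fun i => (g i)%:C%C) (l.1%:C, l.2%:C)%C
    (r.1%:C, r.2%:C)%C n.
Proof.
rewrite /charp rmorph_sweep_pairing /= !complex_hornerC /sweep_pairing.
rewrite (@eq_sweep _ _ (kickC q w z) _ (fun i => (g i)%:C%C)) // => i _ /=.
  rewrite rmorphB rmorphM /= !complex_hornerC.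
  by rewrite /complex_horner /= map_polyX /horner_eval hornerX.
by rewrite complex_hornerC.
Qed.

Section Data.
Variables (q w g : nat -> R) (n : nat).
Hypothesis w_gt0 : forall i, (i <= n)%N -> 0 < w i.
Hypothesis g_neq0 : forall i, (i < n)%N -> g i != 0.
Hypothesis n_gt0 : (0 < n)%N.

Local Notation J := (@Num.conj C).

(** At a zero [z], the final pair and its conjugate satisfy the same nontrivial real linear
    equation, so their Wronskian vanishes. Lagrange's identity then says that [z - J z] times a
    positive sum is zero. *)
Lemma charp_root_real l r z : l != (0, 0) -> r != (0, 0) ->
  complex_horner z (charp q w g l r n) = 0 -> z \is Num.real.
Proof.
move=> l0 r0; rewrite complex_horner_charp /sweep_pairing /=.
set S := sweep _ _ _ => Dz.
have JC (x : R) : J x%:C%C = x%:C%C by exact: conjc_real.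
have SJ i : sweep (kickC q w (J z)) (fun i => (g i)%:C%C) (l.1%:C, l.2%:C)%C i
    = (J (S i).1, J (S i).2).
  rewrite -(rmorph_sweep J) /= !JC; apply: eq_sweep => j _ /=; last exact/esym/JC.
  by rewrite /kickC rmorphB rmorphM /= !JC.
have Dz' : (r.2%:C)%C * J (S n).1 + (r.1%:C)%C * J (S n).2 = 0.
  by rewrite -(rmorph0 J) -Dz rmorphD !rmorphM /= !JC.
have W0 : (S n).1 * J (S n).2 - J (S n).1 * (S n).2 = 0.
  set u := (S n).1 in Dz Dz' *; set v := (S n).2 in Dz Dz' *.
  case: (r) r0 Dz Dz' => r1 r2; rewrite xpair_eqE negb_and /= => r0 Dz Dz'.
  (* Proportionality is obtained by eliminating with whichever coefficient of the boundary equation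
     is nonzero. *)
  have [r10|r10] := eqVneq r1 0.
    have r2C : (r2%:C)%C != 0 :> C.
      by move: r0; rewrite r10 eqxx (fmorph_eq0 (real_complex R)).
    apply: (mulfI r2C); rewrite mulr0.
    have -> : (r2%:C)%C * (u * J v - J u * v)
       = ((r2%:C)%C * u + (r1%:C)%C * v) * J v
         - ((r2%:C)%C * J u + (r1%:C)%C * J v) * v by ring.
    by rewrite Dz Dz' !mul0r subrr.
  have r1C : (r1%:C)%C != 0 :> C by rewrite (fmorph_eq0 (real_complex R)).
  apply: (mulfI r1C); rewrite mulr0.
  have -> : (r1%:C)%C * (u * J v - J u * v)
     = ((r2%:C)%C * J u + (r1%:C)%C * J v) * u
       - ((r2%:C)%C * u + (r1%:C)%C * v) * J u by ring.
  by rewrite Dz Dz' !mul0r subrr.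
have := sweep_lagrange (kickC q w z) (kickC q w (J z)) (fun i => (g i)%:C%C)
  (l.1%:C, l.2%:C)%C n.
rewrite /= SJ /= W0 => /esym.
have -> : \sum_(i < n.+1) (kickC q w (J z) i - kickC q w z i) *
    ((S i).1 * (sweep (kickC q w (J z)) (fun j => (g j)%:C%C)
       (l.1%:C, l.2%:C)%C i).1)
  = (z - J z) * \sum_(i < n.+1) (w i)%:C%C * ((S i).1 * J (S i).1).
  by rewrite mulr_sumr; apply: eq_bigr => i _; rewrite SJ /kickC /=; ring.
move/eqP; rewrite mulf_eq0 subr_eq0 => /orP[/eqP zJ|]; first by apply/CrealP.
have wS i : (i <= n)%N -> 0 <= (w i)%:C%C * ((S i).1 * J (S i).1).
  by move=> le_in; rewrite mulr_ge0 ?mul_conjC_ge0 // lecR ltW ?w_gt0.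
have lC : ((l.1%:C)%C, (l.2%:C)%C) != (0, 0) :> C * C.
  by case: (l) l0 => l1 l2; rewrite !xpair_eqE !(fmorph_eq0 (real_complex R)).
have gC : (g 0%N)%:C%C != 0 :> C by rewrite (fmorph_eq0 (real_complex R)) g_neq0.
rewrite psumr_eq0 => [/allP S0|i _]; last by rewrite wS // -ltnS.
suff S0' i : (i <= n)%N -> (S i).1 = 0.
  have := sweep_neq0 (kickC q w z) (g := fun i => (g i)%:C%C) lC gC.
  by rewrite -/S !S0' // eqxx.
move=> le_in; have := S0 (Ordinal (n := n.+1) (m := i) le_in) (mem_index_enum _).
rewrite /= mulf_eq0 (fmorph_eq0 (real_complex R)) gt_eqF ?w_gt0 //= mulf_eq0 /=.
by rewrite fmorph_eq0 orbb => /eqP.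
Qed.

(** The infinitesimal form of Lagrange's identity: each kick has derivative [- w i] in the spectral
    parameter. *)
Lemma sweepp_wronskian l m :
  let S := sweepp q w g l in
  (S m).1^`() * (S m).2 - (S m).1 * (S m).2^`() =
  \sum_(i < m.+1) (w i)%:P * (S i).1 ^+ 2.
Proof.
move=> S; have dk i : (kickp q w i)^`() = - (w i)%:P.
  by rewrite /kickp !derivE; ring.
elim: m => [|m IHm].
  by rewrite big_ord1 /S /sweepp /= !(dk, derivD, derivM, derivC); ring.
rewrite big_ord_recr -IHm /S /sweepp sweepS2 sweepS1 /=.
by rewrite !(dk, derivD, derivM, derivC); ring.
Qed.

Lemma sweepp_wronskian_gt0 l x (S := sweepp q w g l) : l != (0, 0) ->
  0 < ((S n).1^`() * (S n).2 - (S n).1 * (S n).2^`()).[x].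
Proof.
move=> l0; rewrite sweepp_wronskian horner_sum.
have wS i : (i <= n)%N -> 0 <= ((w i)%:P * (S i).1 ^+ 2).[x].
  by move=> le_in; rewrite hornerM hornerC horner_exp;
    rewrite mulr_ge0 ?sqr_ge0 // ltW ?w_gt0.
rewrite lt_neqAle sumr_ge0 ?andbT => [|i _]; last by rewrite wS // -ltnS.
rewrite eq_sym psumr_eq0 => [|i _]; last by rewrite wS // -ltnS.
apply/negP => /allP S0.
suff S0' i : (i <= n)%N -> (S i).1.[x] = 0.
  (* Evaluation at [x] turns the polynomial sweep into a real one, to which [sweep_neq0] applies. *)
  pose h := [the {rmorphism {poly R} -> R} of horner_eval x].
  have hC c : h c%:P = c by rewrite /= /horner_eval hornerC.
  have hS i : (i <= n)%N -> (sweep (h \o kickp q w) (h \o (fun i => (g i)%:P))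
    (h l.1%:P, h l.2%:P) i).1 = 0.
    have -> := rmorph_sweep h (kickp q w) (fun i => (g i)%:P) (l.1%:P, l.2%:P) i.
    exact: S0'.
  have := @sweep_neq0 R (h \o kickp q w) (h \o (fun i => (g i)%:P))
    (h l.1%:P, h l.2%:P).
  rewrite !hS // !hC -surjective_pairing eqxx => /(_ l0).
  by rewrite [(_ \o _) 0%N]hC g_neq0 // => /(_ isT).
move=> le_in; have := S0 (Ordinal (n := n.+1) (m := i) le_in) (mem_index_enum _).
by rewrite /= hornerM hornerC horner_exp mulf_eq0 gt_eqF ?w_gt0 //= sqrf_eq0 => /eqP.
Qed.

(** [F] and [G] are combinations of the same two polynomials, so their Wronskian is multiplied by
    the determinant of the coefficients. *)
Lemma charp_wronskian l r r' :
  let S := sweepp q w g l in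
  let F := charp q w g l r n in let G := charp q w g l r' n in
  F^`() * G - F * G^`() = (r.2 * r'.1 - r.1 * r'.2)%:P *
     ((S n).1^`() * (S n).2 - (S n).1 * (S n).2^`()).
Proof.
move=> S F G; rewrite /F /G !charpE -/S !(derivD, derivM, derivC).
by rewrite polyCB !polyCM; ring.
Qed.

(* A common zero of D and D' would annihilate the Wronskian of D with any other
   member of the pencil. *)
Lemma charp_simple l r x : l != (0, 0) -> r != (0, 0) ->
  root (charp q w g l r n) x -> (charp q w g l r n)^`().[x] != 0.
Proof.
move=> l0 r0 /rootP Dx; apply/negP => /eqP D'x.
(* Turning [r] by a right angle makes the determinant [r.1 ^+ 2 + r.2 ^+ 2]. *)
have := congr1 (fun p => p.[x]) (charp_wronskian l r (r.2, - r.1)).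
rewrite hornerM hornerD hornerN !hornerM Dx D'x !mul0r subrr => /esym/eqP.
rewrite mulf_eq0 (gt_eqF (sweepp_wronskian_gt0 x l0)) orbF hornerC /=.
rewrite mulrN opprK -!expr2 paddr_eq0 ?sqr_ge0 // !sqrf_eq0 => /andP[r2 r1].
by move: r0; rewrite [r]surjective_pairing xpair_eqE r1 r2.
Qed.

(** Since [w i] is nonzero, the kick has degree exactly one and its product with [p1] dominates
    [p2]. *)
Lemma lead_kick p1 p2 i : (i <= n)%N -> p1 != 0 -> (size p2 <= size p1)%N ->
  let p := p2 + kickp q w i * p1 in
  size p = (size p1).+1 /\ lead_coef p = - w i * lead_coef p1.
Proof.
move=> le_in p10 sz p; have w0 := lt0r_neq0 (w_gt0 le_in).
have kE : kickp q w i = (- w i) *: ('X - (q i / w i)%:P).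
  rewrite /kickp scalerBr -!mul_polyC !polyCN !mulNr opprK -polyCM.
  by rewrite [w i * _]mulrC divfK // addrC.
have szk : size (kickp q w i * p1) = (size p1).+1.
  rewrite kE -scalerAl size_scale ?oppr_eq0 // size_monicM ?monicXsubC //.
  by rewrite size_XsubC.
split; first by rewrite /p addrC size_polyDl szk.
rewrite /p lead_coefDr ?szk // kE -scalerAl lead_coefZ lead_coefM.
by rewrite lead_coefXsubC mul1r.
Qed.

Lemma lead_shear p1 p2 (c : R) : c != 0 -> (size p1 < size p2)%N ->
  size (p1 + c%:P * p2) = size p2 /\
  lead_coef (p1 + c%:P * p2) = c * lead_coef p2.
Proof.
move=> c0 sz; have szc : size (c%:P * p2) = size p2.
  by rewrite mul_polyC size_scale.
split; first by rewrite addrC size_polyDl szc.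
by rewrite lead_coefDr ?szc // mul_polyC lead_coefZ.
Qed.

(** Each kick raises the degree of the second component by one, except the first kick when [l.1] is
    zero, which acts on nothing. *)
Lemma size_sweepp2 l m : l != (0, 0) -> (m <= n)%N ->
  let S := sweepp q w g l in
  size (S m).2 = (m.+1 + (l.1 != 0%R))%N /\ (size (S m).1 < size (S m).2)%N.
Proof.
move=> l0 le_mn S; elim: m le_mn => [|m IHm] lt_mn.
  rewrite /S /=; have [l10|l10] := eqVneq l.1 0.
    rewrite l10 mulr0 addr0 !size_polyC eqxx.
    by move: l0; rewrite [l]surjective_pairing xpair_eqE /= l10 eqxx => ->.
  have [] := @lead_kick l.1%:P l.2%:P 0%N isT; first by rewrite polyC_eq0.
    by rewrite !size_polyC l10; case: (_ != _).
  by rewrite size_polyC l10 => -> _.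
have [szv szu] := IHm (ltnW lt_mn).
have [szu' _] := lead_shear (g_neq0 lt_mn) szu.
have u0 : (S m.+1).1 != 0 by rewrite -size_poly_gt0 [size _]szu' szv.
have [] := @lead_kick (S m.+1).1 (S m).2 m.+1 lt_mn u0.
  by rewrite [size (S m.+1).1]szu'.
by rewrite [size (S m.+1).1]szu' szv => -> _.
Qed.

(** Index 0 is excluded because for [l.1 = 0] the leading coefficient of [(S 0).2] is [l.2], which
    violates the last relation. *)
Lemma lead_sweepp l m : l != (0, 0) -> (0 < m <= n)%N ->
  let S := sweepp q w g l in
  [/\ size (S m).1 = (m + (l.1 != 0%R))%N,
      size (S m).2 = (m + (l.1 != 0%R)).+1 &
      lead_coef (S m).2 = - w m * lead_coef (S m).1].
Proof.
case: m => // m l0 /= lt_mn; set S := sweepp q w g l.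
have [szv szu] := size_sweepp2 l0 (ltnW lt_mn).
have [szu' _] := lead_shear (g_neq0 lt_mn) szu.
have u0 : (S m.+1).1 != 0 by rewrite -size_poly_gt0 [size _]szu' szv.
have [] := @lead_kick (S m.+1).1 (S m).2 m.+1 lt_mn u0.
  by rewrite [size (S m.+1).1]szu'.
by rewrite [size (S m.+1).1]szu' szv.
Qed.

(** The second component has the larger degree, so it determines the leading term unless its
    coefficient [r.1] vanishes. *)
Lemma lead_charp l r : l != (0, 0) -> r != (0, 0) ->
  let S := sweepp q w g l in
  size (charp q w g l r n) = (n + (l.1 != 0%R) + (r.1 != 0%R))%N /\
  lead_coef (charp q w g l r n) =
    if r.1 == 0 then r.2 * lead_coef (S n).1 else r.1 * lead_coef (S n).2.
Proof.
move=> l0 r0 S; have nn : (0 < n <= n)%N by rewrite n_gt0 leqnn.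
have [szu szv _] := lead_sweepp l0 nn; rewrite charpE -/S in szu szv *.
have [r10|r10] := eqVneq r.1 0.
  have r20 : r.2 != 0.
    by move: r0; rewrite [r]surjective_pairing xpair_eqE /= r10 eqxx.
  by rewrite r10 polyC0 mul0r addr0 mul_polyC lead_coefZ size_scale // szu addn0.
have uv : (size (r.2%:P * (S n).1)%R < size (S n).2)%N.
  by rewrite mul_polyC (leq_ltn_trans (size_scale_leq _ _)) // szu szv.
by have [-> ->] := lead_shear r10 uv; rewrite szv addn1.
Qed.

Lemma charp_neq0 l r : l != (0, 0) -> r != (0, 0) -> charp q w g l r n != 0.
Proof.
move=> l0 r0; rewrite -size_poly_gt0; have [-> _] := lead_charp l0 r0; lia.
Qed.

End Data.

(** The roots come from the splitting over [R[i]]; taking real parts loses nothing once all of them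
    are known to be real. *)
Definition root_list p : seq R :=
  sort <=%R (map (@complex.Re R)
    (sval (closed_field_poly_normal (map_poly (real_complex R) p)))).

Lemma root_listP p :
  (forall z, complex_horner z p = 0 -> z \is Num.real) ->
  p = lead_coef p *: \prod_(x <- root_list p) ('X - x%:P).
Proof.
have [->|p0] := eqVneq p 0; first by rewrite lead_coef0 scale0r.
move=> real_roots; apply: (map_poly_inj (real_complex R)).
rewrite /root_list; case: closed_field_poly_normal => /= s Ds.
rewrite map_polyZ rmorph_prod /= -lead_coef_map /= {1}Ds; congr (_ *: _).
rewrite (perm_big (map (@complex.Re R) s)) ?perm_sort //= big_map.
apply: eq_big_seq => z zs; rewrite map_polyXsubC /=; congr ('X - _%:P).
rewrite RRe_real //; apply: real_roots.
rewrite /complex_horner /= /horner_eval Ds hornerZ; apply/eqP.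
by rewrite mulf_eq0 -/(root _ z) root_prod_XsubC zs orbT.
Qed.

End CharacteristicPolynomial.

(** * Simple real zeros of the characteristic polynomial and their interlacing *)

Section Spectrum.
Variable R : realType.
Local Notation C := R[i].
Implicit Types (l r : R * R).

Section RootList.
Variables (q w g : nat -> R) (n : nat).
Hypothesis w_gt0 : forall i, (i <= n)%N -> 0 < w i.
Hypothesis g_neq0 : forall i, (i < n)%N -> g i != 0.
Hypothesis n_gt0 : (0 < n)%N.

Lemma charp_prod l r (D := charp q w g l r n) : l != (0, 0) -> r != (0, 0) ->
  D = lead_coef D *: \prod_(x <- root_list D) ('X - x%:P).
Proof.
move=> l0 r0; apply: root_listP => z; exact: (charp_root_real w_gt0 g_neq0).
Qed.

Lemma root_charp l r (D := charp q w g l r n) x : l != (0, 0) -> r != (0, 0) ->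
  root D x = (x \in root_list D).
Proof.
move=> l0 r0; have DE := charp_prod l0 r0; rewrite -/D in DE.
rewrite {1}DE rootZ ?root_prod_XsubC //.
by rewrite lead_coef_eq0 (charp_neq0 q w_gt0 g_neq0).
Qed.

Lemma root_list_charp_sorted l r : l != (0, 0) -> r != (0, 0) ->
  sorted <%R (root_list (charp q w g l r n)).
Proof.
move=> l0 r0; set D := charp _ _ _ _ _ _.
rewrite lt_sorted_uniq_le sort_le_sorted andbT.
apply: (@uniq_simple_roots _ (lead_coef D)) => x.
by rewrite -root_charp // -charp_prod //; apply: (charp_simple w_gt0 g_neq0).
Qed.

Lemma size_root_list_charp l r : l != (0, 0) -> r != (0, 0) ->
  size (root_list (charp q w g l r n)) =
  (n + (l.1 != 0%R) + (r.1 != 0%R)).-1.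
Proof.
move=> l0 r0; have [<- _] := lead_charp q w_gt0 g_neq0 n_gt0 l0 r0.
rewrite {2}(charp_prod l0 r0) size_scale ?size_prod_XsubC //.
by rewrite lead_coef_eq0 (charp_neq0 q w_gt0 g_neq0).
Qed.

(** The zeros are real and simple, so a complex number occurs once or not at all; this matches
    solution spaces of dimension at most one. *)
Lemma count_root_list_charp l r (D := charp q w g l r n) z :
  l != (0, 0) -> r != (0, 0) ->
  count (fun x => (x%:C == z)%C) (root_list D) = (complex_horner z D == 0).
Proof.
move=> l0 r0; have u := lt_sorted_uniq (root_list_charp_sorted l0 r0).
have hR x : (complex_horner (x%:C)%C D == 0) = root D x.
  by rewrite /complex_horner /= /horner_eval horner_map fmorph_eq0.
have [Dz|Dz] := eqVneq (complex_horner z D) 0.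
  have zR := RRe_real (charp_root_real w_gt0 g_neq0 n_gt0 l0 r0 Dz).
  rewrite -zR (eq_count (a2 := pred1 (complex.Re z))); last first.
    by move=> x /=; apply: (inj_eq (fmorph_inj (real_complex R))).
  rewrite count_uniq_mem // -root_charp //; apply/eqP; rewrite eqb1.
  by rewrite -hR zR Dz.
apply/eqP; rewrite -leqn0 leqNgt -has_count; apply/hasPn => x.
by rewrite -root_charp // -hR; apply: contraTneq => ->.
Qed.

(** At a zero of [F] the product of [F'] and [G] has the sign of the determinant of [r] and [r']. If
    [r'.1] is nonzero, the leading coefficients contribute the sign of [r.1 * r'.1]; if it is zero,
    the degree of [G] is lower by one and the signs agree automatically. *)
Lemma charp_interlacing l r r' :
  l != (0, 0) -> r.1 != 0 ->
  (if r'.1 == 0 then r'.2 != 0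
   else (r.2 * r'.1 - r.1 * r'.2) * (r.1 * r'.1) < 0) ->
  let s := root_list (charp q w g l r n) in
  let t := root_list (charp q w g l r' n) in
  forall i, (i < size t)%N ->
    ((i < size s)%N -> nth 0 s i < nth 0 t i) /\
    ((i.+1 < size s)%N -> nth 0 t i < nth 0 s i.+1).
Proof.
move=> l0 r10 rr' s t.
have r0 : r != (0, 0).
  by rewrite [r]surjective_pairing xpair_eqE negb_and r10.
have r'0 : r' != (0, 0).
  rewrite [r']surjective_pairing xpair_eqE negb_and /=.
  by case: (eqVneq r'.1 0) rr'.
set F := charp q w g l r n in s *; set G := charp q w g l r' n in t *.
have [_ lF] := lead_charp q w_gt0 g_neq0 n_gt0 l0 r0.
have [_ lG] := lead_charp q w_gt0 g_neq0 n_gt0 l0 r'0.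
have nn : (0 < n <= n)%N by rewrite n_gt0 leqnn.
have [szu szv lvu] := lead_sweepp q w_gt0 g_neq0 l0 nn.
have szs := size_root_list_charp l0 r0; have szt := size_root_list_charp l0 r'0.
rewrite -/F -/G -/s -/t in lF lG szs szt.
set u := (sweepp q w g l n).1 in lF lG szu lvu.
set v := (sweepp q w g l n).2 in lF lG szv lvu.
have wn := w_gt0 (leqnn n).
have lu0 : lead_coef u != 0.
  by rewrite lead_coef_eq0 -size_poly_gt0 szu addn_gt0 n_gt0.
apply: (@interlacing R (lead_coef F) (lead_coef G)).
- exact: root_list_charp_sorted.
- exact: root_list_charp_sorted.
- by rewrite szs szt r10; lia.
move=> x xs; rewrite -!charp_prod //.
have Fx : F.[x] = 0 by apply/rootP; rewrite /F root_charp.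
have := congr1 (fun p => p.[x]) (charp_wronskian q w g n l r r').
rewrite /= hornerD hornerN [in LHS]hornerM [(F * _).[x]]hornerM -/F -/G Fx.
rewrite mul0r subr0 hornerM hornerC => ->.
have := sweepp_wronskian_gt0 q w_gt0 g_neq0 n_gt0 x l0; rewrite -/u -/v.
set E := (_ - _).[x] => E0; rewrite lF lG (negPf r10) szs szt r10.
rewrite -signr_odd; set par := odd _.
(* The list [s] has [n + (l.1 != 0)] entries, and [t] has equally many or one fewer. *)
have parE : par = (r'.1 != 0).
  have [k kE] : exists k, (n + (l.1 != 0%R))%N = k.+1.
    by exists (n + (l.1 != 0%R)).-1; rewrite prednK // addn_gt0 n_gt0.
  by rewrite /par kE; case: (r'.1 != 0); clear -k; lia.
rewrite parE; case: ifP rr' => [/eqP r'1|r'1] rr'.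
  rewrite r'1 mulr0 sub0r lvu expr0 mul1r.
  (* The sign in [lead_coef v = - w n * lead_coef u] cancels that of the determinant
     [- (r.1 * r'.2)]. *)
  have -> : r.1 * (- w n * lead_coef u) * (r'.2 * lead_coef u) *
      (- (r.1 * r'.2) * E) = w n * E * (r.1 * r'.2 * lead_coef u) ^+ 2 by ring.
  by rewrite pmulr_rgt0 ?exprn_even_gt0 //= ?mulf_neq0 // mulr_gt0.
have lv0 : lead_coef v != 0.
  by rewrite lvu mulf_neq0 // oppr_eq0 gt_eqF.
rewrite /= expr1.
have -> : (-1 : R) * (r.1 * lead_coef v * (r'.1 * lead_coef v)) *
    ((r.2 * r'.1 - r.1 * r'.2) * E) =
    - ((r.2 * r'.1 - r.1 * r'.2) * (r.1 * r'.1)) * E * lead_coef v ^+ 2.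
  by ring.
by rewrite pmulr_lgt0 ?exprn_even_gt0 // mulr_gt0 ?oppr_gt0.
Qed.

End RootList.
End Spectrum.

(** * Multiplicity of eigenvalues *)

Section Multiplicity.
Variable R : realType.
Local Notation C := R[i].
Variables (N : nat) (f q w : nat -> R).

Lemma sl_residual_linear A B lam : linear (@sl_residual R N f q w A B lam).
Proof.
move=> c x y; apply/rowP => j; rewrite !mxE; rewrite /yat !mxE.
by case: (j == 0 :> nat) => /=; [|case: (j == N.+1 :> nat)]; ring.
Qed.

HB.instance Definition _ A B lam :=
  GRing.isLinear.Build C 'rV[C]_N.+2 'rV[C]_N.+2 *:%R
    (@sl_residual R N f q w A B lam) (sl_residual_linear A B lam).

Lemma sub_sl_solspace A B lam (y : 'rV[C]_N.+2) :
  (y <= sl_solspace N f q w A B lam)%MS = (sl_residual f q w A B lam y == 0).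
Proof. by rewrite sub_kermx mul_rV_lin1. Qed.

Definition quasidiff (y : 'rV[C]_N.+2) k : C :=
  ((f k)%:C)%C * (yat y k.+1 - yat y k).

(** Puts the problem in the form of a first-order system, in which the sweep runs. *)
Lemma sep_residual_eq0 a b lam (y : 'rV[C]_N.+2) :
  sl_residual f q w (sepA a) (sepB b) lam y = 0 <->
  [/\ ((cos a)%:C)%C * yat y 0 - ((sin a)%:C)%C * quasidiff y 0 = 0,
      ((cos b)%:C)%C * yat y N - ((sin b)%:C)%C * quasidiff y N = 0 &
      forall k, (k < N)%N -> quasidiff y k.+1 =
        quasidiff y k + ((q k.+1)%:C - (w k.+1)%:C * lam)%C * yat y k.+1].
Proof.
rewrite /quasidiff; split=> [res0|[bc0 bcN eqn]].
  have res k : (k < N.+2)%N ->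
      sl_residual f q w (sepA a) (sepB b) lam y 0 (inord k) = 0.
    by rewrite res0 mxE.
  split.
  - have := res 0%N isT; rewrite !mxE inordK //= => h.
    by rewrite -[RHS]h !mxE /=; ring.
  - have := res N.+1 (ltnSn _); rewrite !mxE inordK //= eqxx => h.
    by rewrite -[RHS]h !mxE /=; ring.
  move=> k lt_kN; have := res k.+1 (ltn_trans lt_kN (ltnSn _)).
  rewrite !mxE inordK ?ltnS 1?ltnW //= eqSS (ltn_eqF lt_kN).
  move=> h; apply/eqP; rewrite -subr_eq0; apply/eqP.
  by rewrite -[RHS]oppr0 -[in RHS]h; ring.
apply/rowP => j; rewrite !mxE; case: (nat_of_ord j) (ltn_ord j) => [|k] lt_k /=.
  by rewrite -[RHS]bc0 !mxE /=; ring.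
rewrite eqSS; have [_|neq_kN] := eqVneq k N.
  by rewrite -[RHS]bcN !mxE /=; ring.
rewrite eqn; last by rewrite ltn_neqAle neq_kN -2!ltnS.
by ring.
Qed.

Hypothesis f_neq0 : forall k, (k <= N)%N -> f k != 0.
Hypothesis N_gt0 : (0 < N)%N.

(* The initial vector (y_1, f_0 Δy_0), and the boundary functional at N written
   as (u, v) |-> r.2 * u + r.1 * v. *)
Definition left_data (a : R) : R * R := (sin a + cos a / f 0%N, cos a).
Definition right_data (b : R) : R * R := (- sin b, cos b).

(** The sweep starts at site 1, hence the shifted coefficients; after [N.-1] steps it reaches site
    [N]. *)
Definition sep_charp a b : {poly R} :=
  charp (fun i => q i.+1) (fun i => w i.+1) (fun i => (f i.+1)^-1)
    (left_data a) (right_data b) N.-1.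

Section Solution.
Variables (a b : R) (lam : C).
Let S := sweep (kickC (fun i => q i.+1) (fun i => w i.+1) lam)
  (fun i => ((f i.+1)^-1)%:C%C) (((left_data a).1)%:C, ((left_data a).2)%:C)%C.

(** The solution with initial values [sin a] and [cos a], which satisfies the left boundary
    condition by construction. *)
Definition sol_y k : C := if k is k'.+1 then (S k').1 else ((sin a)%:C)%C.
Definition sol_z k : C := if k is k'.+1 then (S k').2 else ((cos a)%:C)%C.

Lemma sol_yz k : (k <= N)%N ->
  ((f k)%:C)%C * (sol_y k.+1 - sol_y k) = sol_z k.
Proof.
move=> /f_neq0 fk; have fkC : ((f k)%:C)%C != 0 :> C.
  by rewrite (fmorph_eq0 (real_complex R)).
case: k fk fkC => [|k] fk fkC.
  by rewrite /= rmorphD rmorphM fmorphV /=; field.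
by rewrite /sol_y /sol_z sweepS1 fmorphV /=; field.
Qed.

Lemma sol_zz k : sol_z k.+1 =
  sol_z k + ((q k.+1)%:C - (w k.+1)%:C * lam)%C * sol_y k.+1.
Proof. by case: k. Qed.

Lemma sol_charp :
  ((cos b)%:C)%C * sol_y N - ((sin b)%:C)%C * sol_z N =
  complex_horner lam (sep_charp a b).
Proof.
rewrite complex_horner_charp /sweep_pairing -/S /= rmorphN mulNr.
by case: N N_gt0.
Qed.

Definition solution : 'rV[C]_N.+2 := \row_j sol_y j.

Lemma yat_solution k : (k <= N.+1)%N -> yat solution k = sol_y k.
Proof. by move=> le_k; rewrite /yat mxE inordK. Qed.

Lemma quasidiff_solution k : (k <= N)%N -> quasidiff solution k = sol_z k.
Proof.
by move=> le_k; rewrite /quasidiff !yat_solution ?sol_yz // leqW.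
Qed.

Lemma solution_neq0 : solution != 0.
Proof.
apply/negP => /eqP s0; have y0 k : yat solution k = 0 by rewrite s0 /yat mxE.
have := y0 0%N; rewrite yat_solution // => /= sin0.
have := quasidiff_solution (leq0n N).
rewrite /quasidiff !y0 subrr mulr0 /= => /esym cos0.
have := cos2Dsin2 a.
have /eqP := sin0; rewrite (fmorph_eq0 (real_complex R)) => /eqP ->.
have /eqP := cos0; rewrite (fmorph_eq0 (real_complex R)) => /eqP ->.
by rewrite expr0n addr0 => /eqP; rewrite eq_sym oner_eq0.
Qed.

Lemma sep_residual_solution :
  sl_residual f q w (sepA a) (sepB b) lam solution = 0 <->
  complex_horner lam (sep_charp a b) = 0.
Proof.
rewrite sep_residual_eq0 !yat_solution ?quasidiff_solution // sol_charp.
split=> [[]//|D0]; split=> // [|k lt_kN]; first by rewrite /=; ring.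
by rewrite !quasidiff_solution ?yat_solution ?sol_zz // ltnW.
Qed.

(* The left boundary condition determines the initial data up to the factor
   y_0 sin a + f_0 (y_1 - y_0) cos a, and the recursion does the rest. *)
Lemma residual0_scale_solution (y : 'rV[C]_N.+2) :
  sl_residual f q w (sepA a) (sepB b) lam y = 0 ->
  exists t : C, y = t *: solution.
Proof.
move=> /sep_residual_eq0[bc0 _ eqn].
pose t := ((sin a)%:C)%C * yat y 0 + ((cos a)%:C)%C * quasidiff y 0.
have cs : ((cos a)%:C)%C ^+ 2 + ((sin a)%:C)%C ^+ 2 = 1 :> C.
  by rewrite -!rmorphXn -rmorphD /= cos2Dsin2.
have y0 : yat y 0 = t * sol_y 0.
  (* With 1 written as the sum of the squares of cosine and sine, the difference of the two sides is
     a multiple of [bc0]. *)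
  rewrite -[LHS]mul1r -cs /t /=; apply/eqP; rewrite -subr_eq0; apply/eqP.
  rewrite -[RHS](mulr0 ((cos a)%:C)%C) -bc0; ring.
have z0 : quasidiff y 0 = t * sol_z 0.
  rewrite -[LHS]mul1r -cs /t /=; apply/eqP; rewrite -subr_eq0; apply/eqP.
  rewrite -[RHS](mulr0 (- ((sin a)%:C)%C)) -bc0; ring.
have step k : (k <= N)%N -> yat y k = t * sol_y k ->
    quasidiff y k = t * sol_z k -> yat y k.+1 = t * sol_y k.+1.
  move=> le_kN yk; have fkC : ((f k)%:C)%C != 0 :> C.
    by rewrite (fmorph_eq0 (real_complex R)) f_neq0.
  rewrite -sol_yz // /quasidiff mulrCA yk => /(mulfI fkC)/eqP.
  by rewrite mulrBr subr_eq subrK => /eqP.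
have yz k : (k <= N)%N -> yat y k = t * sol_y k /\ quasidiff y k = t * sol_z k.
  elim: k => [//|k IHk] lt_kN; have [yk zk] := IHk (ltnW lt_kN).
  have yS := step k (ltnW lt_kN) yk zk.
  by split=> //; rewrite eqn // zk yS sol_zz; ring.
exists t; apply/rowP => j; rewrite !mxE.
have -> : y 0 j = yat y j by rewrite /yat inord_val.
case: (nat_of_ord j) (ltn_ord j) => [|k] lt_k //.
by have [yk zk] := yz k lt_k; apply: step.
Qed.

(** The solution space lies in the line spanned by [solution], and it is the whole line exactly when
    the right boundary condition holds. *)
Lemma sep_mult :
  sl_mult N f q w (sepA a) (sepB b) lam =
  (complex_horner lam (sep_charp a b) == 0).
Proof.
rewrite /sl_mult; set V := sl_solspace _ _ _ _ _ _ _.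
have V_sol : (V <= solution)%MS.
  apply/row_subP => i.
  have : (row i V <= V)%MS by exact: row_sub.
  rewrite sub_sl_solspace => /eqP/residual0_scale_solution[t ->].
  exact: scalemx_sub.
have [D0|D0] := eqVneq (complex_horner lam (sep_charp a b)) 0.
  have sol_V : (solution <= V)%MS.
    by rewrite sub_sl_solspace; apply/eqP/sep_residual_solution.
  have -> : \rank V = \rank solution by apply/eqP; rewrite eqn_leq !mxrankS.
  by rewrite rank_rV solution_neq0.
apply/eqP; rewrite mxrank_eq0; apply/rowV0P => v vV.
have /sub_rVP[t vE] := submx_trans vV V_sol.
have [t0|t0] := eqVneq t 0; first by rewrite vE t0 scale0r.
have : (solution <= V)%MS by rewrite -(eqmx_scale _ t0) -vE.
rewrite sub_sl_solspace => /eqP/sep_residual_solution D0'.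
by rewrite D0' eqxx in D0.
Qed.

End Solution.
End Multiplicity.

(** * Boundary angles *)

Section Angles.
Variable R : realType.
Implicit Types x y a b : R.

Lemma sinB_gt0 x y : x < y -> y < x + pi -> 0 < sin (y - x).
Proof. by move=> xy yx; apply: sin_gt0_pi; rewrite subr_gt0 xy ltrBlDl. Qed.

Lemma sinB_lt0 x y : x < y -> y < x + pi -> sin (x - y) < 0.
Proof. by move=> xy yx; rewrite -opprB sinN oppr_lt0 sinB_gt0. Qed.

Lemma sincos_neq0 x : sin x = 0 -> cos x != 0.
Proof.
move=> s0; apply/negP => /eqP c0; have := cos2Dsin2 x.
by rewrite s0 c0 expr0n addr0 => /esym/eqP; rewrite oner_eq0.
Qed.

Lemma right_data_neq0 b : right_data b != (0, 0).
Proof.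
by rewrite xpair_eqE negb_and oppr_eq0; have [/sincos_neq0 ->|] := eqVneq (sin b) 0.
Qed.

Lemma right_data1_eq0 b : 0 < b <= pi -> ((right_data b).1 == 0) = (b == pi).
Proof.
move=> /andP[b0]; rewrite le_eqVlt /= oppr_eq0 => /orP[/eqP->|bpi].
  by rewrite sinpi !eqxx.
by rewrite (lt_eqF bpi) gt_eqF // sin_gt0_pi // b0.
Qed.

Variable f : nat -> R.
Hypothesis f0 : f 0%N != 0.
Local Notation xi := (xi_of (f 0%N)).

Lemma left_data_neq0 a : left_data f a != (0, 0).
Proof.
rewrite xpair_eqE negb_and; have [c0|//] := eqVneq (cos a) 0; last by rewrite orbT.
rewrite c0 mul0r addr0 orbF; apply: contraL (introT eqP c0) => /eqP.
exact: sincos_neq0.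
Qed.

(** The equation characterizes [xi] as the angle at which the initial value [sin a + cos a / f 0]
    vanishes. Adding [pi] changes the signs of sine and cosine together, so it is preserved by the
    shift. *)
Lemma xi_spec : [/\ 0 < xi < pi, cos xi != 0 & cos xi / f 0%N = - sin xi].
Proof.
have pi0 := pi_gt0 R.
set t := atan (- 1 / f 0%N).
have [tl tu] : - (pi / 2) < t /\ t < pi / 2.
  by split; [apply: atan_gtNpi2 | apply: atan_ltpi2].
have ct : 0 < cos t by apply: cos_gt0_pihalf; rewrite tl tu.
have tE : sin t = - cos t / f 0%N.
  have : tan t = - 1 / f 0%N by exact: atanK.
  rewrite /tan => /(congr1 (fun z => z * cos t)); rewrite divfK ?gt_eqF // => ->.
  by rewrite mulrAC mulN1r.
have ct0 := lt0r_neq0 ct.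
rewrite /xi_of -/t; case: (ltgtP (f 0%N) 0) f0 => // [fneg|fpos] _; last first.
  rewrite cosDpi sinDpi oppr_eq0 tE; split=> //; last by rewrite opprK.
  have t0 : t < 0.
    rewrite ltNge; apply/negP => t0.
    have : 0 <= sin t by apply: sin_ge0_pi; rewrite t0; lra.
    by rewrite tE mulNr oppr_ge0 leNgt divr_gt0.
  by lra.
split=> //; last by rewrite tE mulNr opprK.
have t0 : 0 < t.
  rewrite ltNge; apply/negP => t0.
  have : 0 <= sin (- t) by apply: sin_ge0_pi; rewrite oppr_ge0 t0; lra.
  by rewrite sinN tE mulNr opprK leNgt pmulr_rlt0 ?invr_lt0 ?fneg.
by lra.
Qed.

(** Gives the sign of the initial value up to the fixed factor [cos xi], which enters later
    comparisons only through its square. *)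
Lemma left_data1_cos_xi a : (left_data f a).1 * cos xi = sin (a - xi).
Proof.
have [_ _ xiE] := xi_spec; rewrite /left_data /= mulrDl -mulrA [_^-1 * _]mulrC.
by rewrite xiE sinB; ring.
Qed.

Lemma left_data1_eq0 a : 0 <= a < pi -> ((left_data f a).1 == 0) = (a == xi).
Proof.
move=> /andP[a0 api]; have [/andP[xi0 xipi] cx _] := xi_spec.
rewrite -(mulIr_eq0 _ (mulIf cx)) left_data1_cos_xi.
case: (ltgtP a xi) => [lt|gt|->]; last by rewrite subrr sin0 eqxx.
- by rewrite lt_eqF // sinB_lt0 //; lra.
- by rewrite gt_eqF // sinB_gt0 //; lra.
Qed.

End Angles.

(** * Dependence of the eigenvalues on each boundary angle *)

Section SeparatedProblem.
Variables (R : realType) (N : nat) (f q w : nat -> R).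
Hypothesis N_ge2 : (2 <= N)%N.
Hypothesis f_neq0 : forall n, (n <= N)%N -> f n != 0.
Hypothesis w_gt0 : forall n, (1 <= n <= N)%N -> 0 < w n.
Local Notation xi := (xi_of (f 0%N)).
Implicit Types a b : R.

Definition sep_eigenvalues a b := root_list (sep_charp N f q w a b).

Let n_gt0 : (0 < N.-1)%N. Proof. by case: N N_ge2 => [|[]]. Qed.

Let w_gt0S i : (i <= N.-1)%N -> 0 < w i.+1.
Proof. by move=> le_i; apply: w_gt0; lia. Qed.

Let g_neq0 i : (i < N.-1)%N -> (f i.+1)^-1 != 0.
Proof. by move=> lt_i; rewrite invr_eq0 f_neq0 //; lia. Qed.

Let f0 : f 0%N != 0. Proof. exact: f_neq0. Qed.

Lemma sep_eigenvaluesP a b : sep_eigenlist N f q w a b (sep_eigenvalues a b).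
Proof.
have l0 := left_data_neq0 f a; have r0 := right_data_neq0 b.
split=> [|z].
  apply: sub_sorted (@ltW _ _) _ _.
  exact: (root_list_charp_sorted _ w_gt0S g_neq0 n_gt0 l0 r0).
rewrite sep_mult //; last exact: ltnW.
exact: (count_root_list_charp _ w_gt0S g_neq0 n_gt0 z l0 r0).
Qed.

Lemma size_sep_eigenvalues a b : 0 <= a < pi -> 0 < b <= pi ->
  size (sep_eigenvalues a b) = (N.-2 + (a != xi) + (b != pi))%N.
Proof.
move=> aI bI; have l0 := left_data_neq0 f a; have r0 := right_data_neq0 b.
rewrite /sep_eigenvalues (size_root_list_charp _ w_gt0S g_neq0 n_gt0 l0 r0).
by rewrite left_data1_eq0 // right_data1_eq0 //; lia.
Qed.

(** The four alternatives say that [a] precedes [a'] when angles run from [xi] down to 0 and then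
    from [pi] down to [xi], with [xi] itself coming last. *)
Lemma sep_eigenvalues_left a a' b :
  0 <= a < pi -> 0 <= a' < pi -> a != xi ->
  [\/ a' = xi, a' < a < xi, a < xi < a' | xi < a' < a] ->
  let s := sep_eigenvalues a b in let t := sep_eigenvalues a' b in
  forall i, (i < size t)%N ->
    ((i < size s)%N -> nth 0 s i < nth 0 t i) /\
    ((i.+1 < size s)%N -> nth 0 t i < nth 0 s i.+1).
Proof.
move=> aI a'I axi ord; rewrite /sep_eigenvalues /sep_charp.
(* Reversal turns the left data into the varying boundary vector. *)
rewrite ![charp _ _ _ (left_data _ _) _ _]charp_rev.
have [/andP[xi0 xipi] cx _] := xi_spec f0.
apply: charp_interlacing.
- by move=> i le_i; apply: w_gt0S; lia.
- by move=> i lt_i; apply: g_neq0; lia.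
- exact: n_gt0.
- exact: right_data_neq0.
- by rewrite left_data1_eq0.
case: ifP => [/eqP l1|].
  have := left_data_neq0 f a'; rewrite [left_data f a']surjective_pairing.
  by rewrite xpair_eqE l1 eqxx.
rewrite left_data1_eq0 // => /negbT a'xi.
have c2 : 0 < cos xi ^+ 2 by rewrite exprn_even_gt0.
(* The factor [cos xi ^+ 2] converts both first components into sines. *)
rewrite -(pmulr_llt0 _ c2).
have -> : (left_data f a).2 * (left_data f a').1 -
    (left_data f a).1 * (left_data f a').2 = sin (a' - a).
  by rewrite /left_data /= sinB; ring.
have -> : sin (a' - a) * ((left_data f a).1 * (left_data f a').1) * cos xi ^+ 2
  = sin (a' - a) * (sin (a - xi) * sin (a' - xi)).
  by rewrite -!(left_data1_cos_xi f0); ring.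
case: ord => [a'E|/andP[lt1 lt2]|/andP[lt1 lt2]|/andP[lt1 lt2]].
- by rewrite a'E eqxx in a'xi.
- rewrite nmulr_rlt0 ?sinB_lt0 ?nmulr_rgt0 ?sinB_lt0 //; lra.
- rewrite pmulr_rlt0 ?sinB_gt0 ?nmulr_rlt0 ?sinB_lt0 ?sinB_gt0 //; lra.
- rewrite nmulr_rlt0 ?sinB_lt0 ?pmulr_rgt0 ?sinB_gt0 //; lra.
Qed.

(** The determinant is [sin (b - b')], which is negative, while both first components are negative
    for angles below [pi]; at [b' = pi] the second one vanishes. *)
Lemma sep_eigenvalues_right a b b' : 0 < b -> b < b' -> b' <= pi ->
  let s := sep_eigenvalues a b in let t := sep_eigenvalues a b' in
  forall i, (i < size t)%N ->
    ((i < size s)%N -> nth 0 s i < nth 0 t i) /\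
    ((i.+1 < size s)%N -> nth 0 t i < nth 0 s i.+1).
Proof.
move=> b0 bb' b'pi; have bI : 0 < b <= pi by lra.
have b'I : 0 < b' <= pi by lra.
apply: charp_interlacing => //; first exact: left_data_neq0.
  by rewrite right_data1_eq0 // lt_eqF //; lra.
rewrite right_data1_eq0 //; case: ifPn => [/eqP -> /=|b'N].
  by rewrite cospi oppr_eq0 oner_eq0.
have -> : (right_data b).2 * (right_data b').1 -
    (right_data b).1 * (right_data b').2 = sin (b - b').
  by rewrite /right_data /= sinB; ring.
rewrite /= mulrNN nmulr_rlt0 ?sinB_lt0 //; last by lra.
rewrite mulr_gt0 // sin_gt0_pi // ?b0 ?(lt_le_trans bb') ?(lt_trans b0 bb') //.
by rewrite lt_neqAle b'N.
Qed.

End SeparatedProblem.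

Theorem theorem3p1 (R : realType) (N : nat) (f q w : nat -> R) :
  (2 <= N)%N ->
  (forall n : nat, (n <= N)%N -> f n != 0) ->
  (forall n : nat, (1 <= n <= N)%N -> 0 < w n) ->
  let xi := xi_of (f 0%N) in
  exists lam : R -> R -> seq R,
    (* lam a b is the ordered list of eigenvalues for S_{a,b} *)
    (forall a b : R, 0 <= a < pi -> 0 < b <= pi ->
       sep_eigenlist N f q w a b (lam a b)) /\
    (* number of eigenvalues *)
    (forall a b : R, 0 <= a < pi -> 0 < b <= pi ->
       [/\ (a != xi -> b != pi -> size (lam a b) = N),
           (a != xi -> b = pi -> size (lam a b) = N.-1),
           (a = xi -> b != pi -> size (lam a b) = N.-1) &
           (a = xi -> b = pi -> size (lam a b) = N.-2)]) /\
    (* (i) and (ii) *)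
    (forall a1 a2 a3 a4 : R,
       0 <= a1 -> a1 < a2 -> a2 < xi -> xi <= a3 -> a3 < a4 -> a4 < pi ->
       (forall b0 : R, 0 < b0 < pi ->
          (forall n : nat, (n <= N.-2)%N ->
             [/\ nth 0 (lam a2 b0) n < nth 0 (lam a1 b0) n,
                 nth 0 (lam a1 b0) n < nth 0 (lam a4 b0) n,
                 nth 0 (lam a4 b0) n < nth 0 (lam a3 b0) n &
                 nth 0 (lam a3 b0) n < nth 0 (lam a2 b0) n.+1]) /\
          (nth 0 (lam a2 b0) N.-1 < nth 0 (lam a1 b0) N.-1 /\
           nth 0 (lam a1 b0) N.-1 < nth 0 (lam a4 b0) N.-1) /\
          (a3 != xi -> nth 0 (lam a4 b0) N.-1 < nth 0 (lam a3 b0) N.-1)) /\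
       ((forall n : nat, (n.+3 <= N)%N ->
             [/\ nth 0 (lam a2 pi) n < nth 0 (lam a1 pi) n,
                 nth 0 (lam a1 pi) n < nth 0 (lam a4 pi) n,
                 nth 0 (lam a4 pi) n < nth 0 (lam a3 pi) n &
                 nth 0 (lam a3 pi) n < nth 0 (lam a2 pi) n.+1]) /\
          (nth 0 (lam a2 pi) N.-2 < nth 0 (lam a1 pi) N.-2 /\
           nth 0 (lam a1 pi) N.-2 < nth 0 (lam a4 pi) N.-2) /\
          (a3 != xi -> nth 0 (lam a4 pi) N.-2 < nth 0 (lam a3 pi) N.-2))) /\
    (* (iii) and (iv) *)
    (forall b1 b2 : R, 0 < b1 -> b1 < b2 -> b2 <= pi ->
       (forall a0 : R, 0 <= a0 < pi -> a0 != xi ->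
          (forall n : nat, (n <= N.-2)%N ->
             nth 0 (lam a0 b1) n < nth 0 (lam a0 b2) n /\
             nth 0 (lam a0 b2) n < nth 0 (lam a0 b1) n.+1) /\
          (b2 != pi -> nth 0 (lam a0 b1) N.-1 < nth 0 (lam a0 b2) N.-1)) /\
       ((forall n : nat, (n.+3 <= N)%N ->
             nth 0 (lam xi b1) n < nth 0 (lam xi b2) n /\
             nth 0 (lam xi b2) n < nth 0 (lam xi b1) n.+1) /\
          (b2 != pi -> nth 0 (lam xi b1) N.-2 < nth 0 (lam xi b2) N.-2))).
Proof.
move=> N2 fN wN xi.
have [/andP[xi0 xipi] _ _] := xi_spec (fN 0%N isT); rewrite -/xi in xi0 xipi.
exists (sep_eigenvalues N f q w); split=> [a b _ _|].
  exact: sep_eigenvaluesP.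
have sz a b (aI : 0 <= a < pi) (bI : 0 < b <= pi) :=
  size_sep_eigenvalues q N2 fN wN aI bI.
rewrite -/xi in sz.
split=> [a b aI bI|].
  rewrite sz //; split=> [-> ->|-> ->|-> ->|-> ->]; rewrite ?eqxx /=;
    move: N2; clear; lia.
split=> [a1 a2 a3 a4 a10 a12 a2xi xia3 a34 a4pi|b1 b2 b10 b12 b2pi].
  have left a a' b :=
    sep_eigenvalues_left (q := q) N2 fN wN (a := a) (a' := a') (b := b).
  rewrite -/xi in left.
  have a1I : 0 <= a1 < pi by lra.
  have a2I : 0 <= a2 < pi by lra.
  have a3I : 0 <= a3 < pi by lra.
  have a4I : 0 <= a4 < pi by lra.
  have a1xi : a1 != xi by rewrite lt_eqF //; lra.
  have a2xi' : a2 != xi by rewrite lt_eqF.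
  have a4xi : a4 != xi by rewrite gt_eqF //; lra.
  (* The first inequalities of [L21], [L14] and [L43] form the chain at a fixed index; the second
     one of [L23] links it to the next index. *)
  have L21 b := left a2 a1 b a2I a1I a2xi' ltac:(apply: Or42; lra).
  have L14 b := left a1 a4 b a1I a4I a1xi ltac:(apply: Or43; lra).
  have ord43 : [\/ a3 = xi, a3 < a4 < xi, a4 < xi < a3 | xi < a3 < a4].
    by case: (ltgtP xi a3) xia3 => // [lt|->] _; [apply: Or44; lra | apply: Or41].
  have L43 b := left a4 a3 b a4I a3I a4xi ord43.
  have ord23 : [\/ a3 = xi, a3 < a2 < xi, a2 < xi < a3 | xi < a3 < a2].
    by case: (ltgtP xi a3) xia3 => // [lt|->] _; [apply: Or43; lra | apply: Or41].
  have L23 b := left a2 a3 b a2I a3I a2xi' ord23.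
  split=> [b0 /andP[b00 b0pi]|].
    have bI : 0 < b0 <= pi by rewrite b00 ltW.
    have bpi : b0 != pi by rewrite lt_eqF.
    have s1 := sz a1 b0 a1I bI; have s2 := sz a2 b0 a2I bI.
    have s3 := sz a3 b0 a3I bI; have s4 := sz a4 b0 a4I bI.
    (* The test [a3 != xi] stays in [s3]: at [a3 = xi] the list has [N.-1] entries, so only index
       [N.-1] requires it. *)
    rewrite a1xi a2xi' a4xi bpi /= in s1 s2 s3 s4.
    split=> [i le_i|]; [|split; [split|]].
    - split.
      + by apply: (L21 b0 i _).1; rewrite ?s1 ?s2; move: N2 le_i; clear; lia.
      + by apply: (L14 b0 i _).1; rewrite ?s1 ?s4; move: N2 le_i; clear; lia.
      + by apply: (L43 b0 i _).1; rewrite ?s3 ?s4; move: N2 le_i; clear; lia.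
      + by apply: (L23 b0 i _).2; rewrite ?s3 ?s2; move: N2 le_i; clear; lia.
    - by apply: (L21 b0 _ _).1; rewrite ?s1 ?s2; move: N2; clear; lia.
    - by apply: (L14 b0 _ _).1; rewrite ?s1 ?s4; move: N2; clear; lia.
    - move=> a3xi; rewrite a3xi in s3.
      by apply: (L43 b0 _ _).1; rewrite ?s3 ?s4; move: N2; clear; lia.
  have bI : 0 < (pi : R) <= pi by rewrite pi_gt0 lexx.
  have s1 := sz a1 pi a1I bI; have s2 := sz a2 pi a2I bI.
  have s3 := sz a3 pi a3I bI; have s4 := sz a4 pi a4I bI.
  (* At [pi] every list is one shorter. The bound [n.+3 <= N] avoids truncated subtraction, so the
     range is empty for [N = 2]. *)
  rewrite a1xi a2xi' a4xi eqxx /= in s1 s2 s3 s4.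
  split=> [i le_i|]; [|split; [split|]].
  - split.
    + by apply: (L21 pi i _).1; rewrite ?s1 ?s2; move: N2 le_i; clear; lia.
    + by apply: (L14 pi i _).1; rewrite ?s1 ?s4; move: N2 le_i; clear; lia.
    + by apply: (L43 pi i _).1; rewrite ?s3 ?s4; move: N2 le_i; clear; lia.
    + by apply: (L23 pi i _).2; rewrite ?s3 ?s2; move: N2 le_i; clear; lia.
  - by apply: (L21 pi _ _).1; rewrite ?s1 ?s2; move: N2; clear; lia.
  - by apply: (L14 pi _ _).1; rewrite ?s1 ?s4; move: N2; clear; lia.
  - move=> a3xi; rewrite a3xi in s3.
    by apply: (L43 pi _ _).1; rewrite ?s3 ?s4; move: N2; clear; lia.
have b1I : 0 < b1 <= pi by lra.
have b2I : 0 < b2 <= pi by lra.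
have b1pi : b1 != pi by rewrite lt_eqF //; lra.
have L a := sep_eigenvalues_right (q := q) N2 fN wN (a := a) b10 b12 b2pi.
split=> [a0 aI axi|].
  have s1 := sz a0 b1 aI b1I; have s2 := sz a0 b2 aI b2I.
  rewrite axi b1pi /= in s1 s2.
  (* The second list loses its last entry when [b2 = pi], so [b2 != pi] is used only for the top
     index. *)
  split=> [i le_i|b2N]; last rewrite b2N in s2.
    by split; [apply: (L a0 i _).1 | apply: (L a0 i _).2];
      rewrite ?s1 ?s2; move: N2 le_i; clear; lia.
  by apply: (L a0 _ _).1; rewrite ?s1 ?s2; move: N2; clear; lia.
have xiI : 0 <= xi < pi by lra.
have s1 := sz xi b1 xiI b1I; have s2 := sz xi b2 xiI b2I.
rewrite eqxx b1pi /= in s1 s2.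
split=> [i le_i|b2N]; last rewrite b2N in s2.
  by split; [apply: (L xi i _).1 | apply: (L xi i _).2];
    rewrite ?s1 ?s2; move: N2 le_i; clear; lia.
by apply: (L xi _ _).1; rewrite ?s1 ?s2; move: N2; clear; lia.
Qed.
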